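(* Černý's conjecture holds if and only if for every finite non-empty alphabet $\Sigma$, every $\mathscr{B}\in\mathcal{L}(\Sigma)$, every integer $k<\sqrt{\|\mathrm{Syn}(\mathscr{B})\|}+1$ and every $\rho\in\mathrm{Cong}_{k}(\mathscr{B})$ we have $$\|\mathrm{Syn}(\mathscr{B}/\rho)\|<\|\mathrm{Syn}(\mathscr{B})\|.$$
   Context: A DFA $\langle Q,\Sigma,\delta\rangle$ has a finite non-empty state set and a totally defined transition function $\delta:Q\times\Sigma\to Q$, extended to words; it may also carry an initial state $q_0$ and a set $F$ of final states, and then $L[\mathscr{A}]=\{u\in\Sigma^*: \delta(q_0,u)\in F\}$. A word $u$ is reset for $\mathscr{A}$ if $\delta(q,u)=\delta(q',u)$ for all $q,q'\in Q$; $\mathrm{Syn}(\mathscr{A})$ is the set of reset words; $\mathscr{A}$ is synchronizing if $\mathrm{Syn}(\mathscr{A})\neq\emptyset$. Černý's conjecture is the statement that every synchronizing automaton with $n$ states (over any finite alphabet) has a reset word of length at most $(n-1)^2$. For a non-empty language $I$, $\|I\|$ is the minimal length of a word in $I$. $w^{-1}\Sigma^*w=\{v\in\Sigma^*: wv\in\Sigma^*w\}$. A DFA with initial state $q_0$ and final set $F$ is trim if each state is reachable from $q_0$ and each state in $F$ is reachable from some state. $\mathcal{L}(\Sigma)$ is the class of all trim DFAs $\langle Q,\Sigma,\delta,q_0,\{q_0\}\rangle$ (initial state equal to the unique final state) whose recognized language is $w^{-1}\Sigma^*w$ for some $w\in\Sigma^*$ (all such automata are synchronizing). A congruence of a DFA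 is an equivalence relation $\rho$ on $Q$ such that $(q_1,q_2)\in\rho$ implies $(\delta(q_1,u),\delta(q_2,u))\in\rho$ for all $u\in\Sigma^*$; the quotient $\mathscr{B}/\rho$ has state set $Q/\rho$ and transitions $\delta'([q],u)=[\delta(q,u)]$. The index of $\rho$ is $|Q/\rho|$, and $\mathrm{Cong}_k(\mathscr{B})$ is the (possibly empty) set of congruences of $\mathscr{B}$ of index $k$. *)

(* Defs.v *)
From HB Require Import structures.
From mathcomp Require Import all_boot all_order all_algebra realalg.

Set Implicit Arguments.
Unset Strict Implicit.
Unset Printing Implicit Defensive.

Import Order.TTheory GRing.Theory Num.Theory.

Section MinLength.
Variables (S : finType) (I : pred (seq S)).

Definition has_length (n : nat) : bool := [exists u : n.-tuple S, I u].

Lemma has_length_ne : (exists u, I u) -> exists n, has_length n.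
Proof.
by case=> u Iu; exists (size u); apply/existsP; exists (in_tuple u).
Qed.

Definition min_length (I_ne : exists u, I u) : nat := ex_minn (has_length_ne I_ne).

Lemma min_lengthP (I_ne : exists u, I u) :
  (exists2 u, I u & size u = min_length I_ne) /\
  (forall u, I u -> min_length I_ne <= size u).
Proof.
rewrite /min_length; case: ex_minnP => n /existsP[u Iu] n_min; split.
  by exists u; rewrite ?size_tuple.
by move=> v Iv; apply/n_min/existsP; exists (in_tuple v).
Qed.
End MinLength.

Record dfa (S : finType) := Dfa {
  state :> finType;
  state_gt0 : 0 < #|state|;
  trans : state -> S -> state
}.

Section Dfa.
Variables (S : finType) (A : dfa S).

Definition delta (q : A) (u : seq S) : A := foldl (@trans S A) q u.

Definition Syn : pred (seq S) :=
  fun u => [forall q : A, forall q' : A, delta q u == delta q' u].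

Definition synchronizing : Prop := exists u, Syn u.

Lemma SynP u : reflect (forall q q' : A, delta q u = delta q' u) (Syn u).
Proof.
apply: (iffP 'forall_forallP) => [h q q'|h q q']; first exact/eqP.
exact/eqP.
Qed.

Record congruence := Congruence {
  cong_rel :> equiv_rel A;
  cong_delta : forall (q1 q2 : A) (u : seq S),
    cong_rel q1 q2 -> cong_rel (delta q1 u) (delta q2 u)
}.
End Dfa.

Definition Cerny_conjecture : Prop :=
  forall (S : finType) (A : dfa S), synchronizing A ->
  exists2 u, Syn A u & size u <= (#|A| - 1) ^ 2.

Section Quotient.
Local Open Scope quotient_scope.
Variables (S : finType) (A : dfa S) (rho : congruence A).

Definition quot_state : predArgType := {eq_quot rho}.
HB.instance Definition _ := Choice.on quot_state.
HB.instance Definition _ := EqQuotient.on quot_state.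
HB.instance Definition _ :=
  isCountable.Build quot_state (pcan_pickleK (can_pcan (@reprK _ quot_state))).
HB.instance Definition _ :=
  isFinite.Build quot_state (pcan_enumP (can_pcan (@reprK _ quot_state))).

(* Well defined on classes: see [quot_delta]. *)
Definition quot_trans (x : quot_state) (a : S) : quot_state :=
  \pi_quot_state (trans (repr x) a).

Lemma quot_state_gt0 : 0 < #|quot_state|.
Proof.
by have /card_gt0P[q _] := state_gt0 A; apply/card_gt0P; exists (\pi_quot_state q).
Qed.

Definition quotient : dfa S := Dfa quot_state_gt0 quot_trans.

Definition cong_index : nat := #|quot_state|.

Lemma quot_delta (q : A) (u : seq S) :
  @delta S quotient (\pi_quot_state q) u = \pi_quot_state (delta q u).
Proof.
elim: u q => //= a u IHu q; rewrite -IHu /=; congr (foldl _ _ _).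
apply/eqmodP; apply: (cong_delta [:: a]).
by apply/eqmodP; rewrite reprK.
Qed.

Lemma quotient_sync : synchronizing A -> synchronizing quotient.
Proof.
case=> u /SynP uA; exists u; apply/SynP => x y.
by rewrite -(reprK x) -(reprK y) !quot_delta (uA _ (repr y)).
Qed.
End Quotient.

Definition Cong (S : finType) (A : dfa S) (k : int) (rho : congruence A) : Prop :=
  ((cong_index rho)%:Z = k)%R.

Record acceptor (S : finType) := Acceptor {
  base :> dfa S;
  init : base;
  final : {set base}
}.

Section Acceptor.
Variables (S : finType) (A : acceptor S).

Definition language : pred (seq S) := fun u => delta (init A) u \in final A.

Definition reachable (p q : A) : Prop := exists u, delta p u = q.

(* Taken literally, the second clause always holds (p := q); co-accessibility
   of all states would follow anyway for the automata of [in_calL] below. *)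
Definition trim : Prop :=
  (forall q : A, reachable (init A) q) /\
  (forall q : A, q \in final A -> exists p : A, reachable p q).
End Acceptor.

(* [lquot_suffix w] is w^-1 Sigma^* w. *)
Definition lquot_suffix (S : finType) (w : seq S) : pred (seq S) :=
  fun v => suffix w (w ++ v).

Record in_calL (S : finType) (B : acceptor S) : Prop := InCalL {
  calL_trim : trim B;
  calL_final : final B = [set init B];
  calL_lang : exists w, language B =1 lquot_suffix w
}.

Lemma calL_sync (S : finType) (B : acceptor S) : in_calL B -> synchronizing B.
Proof.
case=> -[reach _] finE [w langE]; exists w.
suff to0 q : delta q w = init B by apply/SynP => q q'; rewrite !to0.
have [u <-] := reach q; apply/set1P; rewrite -finE /delta -foldl_cat.
by rewrite -[_ \in _]/(language B (u ++ w)) langE /lquot_suffix catA suffix_suffix.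
Qed.

(* Main.v *)
Require Import Defs.
From mathcomp Require Import all_boot all_order all_algebra realalg.
From mathcomp Require Import zify.

Set Implicit Arguments.
Unset Strict Implicit.
Unset Printing Implicit Defensive.

Import Order.TTheory GRing.Theory Num.Theory.

(* If Cerny's conjecture holds, B/rho with k states has a reset word of length
   at most (k-1)^2, which is less than ||Syn B|| as k < sqrt ||Syn B|| + 1.
   Conversely, let A be strongly connected with n states, and let w be a
   shortest reset word of A, sending every state to q0. Pair A with a register
   holding the last |w| letters read, and let B be the part reachable from
   (q0, w). Then B recognizes w^-1 Sigma^* w, it is reset by w, and A is the
   quotient of B by the kernel of the first projection, so that
   ||Syn (B/rho)|| = ||Syn B|| = |w|. The assumption thus rules out
   |w| > (n-1)^2. For a general A, let C be the strongly connected sink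
   component and s = n - |C|: at most s words of length at most s each send the
   states outside C into C, and s^2 + (|C|-1)^2 <= (n-1)^2. *)

(** * Short words leading into a set of states *)

Section DeltaFacts.
Variables (S : finType) (A : dfa S).

Lemma delta_cat (q : A) (u v : seq S) : delta q (u ++ v) = delta (delta q u) v.
Proof. exact: foldl_cat. Qed.

(** Along a shortest such word the states before the last letter is read avoid [C] and are pairwise
    distinct, since a loop could be cut out. *)
Lemma short_word_to (C : {set A}) (q : A) :
  (exists u, delta q u \in C) ->
  exists2 u, delta q u \in C & size u <= #|~: C|.
Proof.
move=> qC; have [[u uC u_min] min] := min_lengthP qC; exists u => //.
rewrite -u_min in min.
pose f (i : 'I_(size u)) := delta q (take i u).
have f_lt (i j : 'I_(size u)) : i < j -> f i != f j.
  move=> ltij; apply/eqP => eqf.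
  have /min : delta q (take i u ++ drop j u) \in C.
    by rewrite delta_cat -/(f i) eqf -delta_cat cat_take_drop.
  by rewrite size_cat size_drop (size_takel (ltnW (ltn_ord i))); have := ltn_ord j; lia.
have f_inj : injective f.
  move=> i j eqf; apply/val_inj; case: (ltngtP i j) => // /f_lt.
    by rewrite eqf eqxx.
  by rewrite eqf eqxx.
rewrite -[size u]card_ord -(card_codom f_inj); apply/subset_leq_card.
apply/subsetP => _ /codomP[i ->]; rewrite inE; apply/negP => /min.
by rewrite (size_takel (ltnW (ltn_ord i))) leqNgt ltn_ord.
Qed.

(** The states outside [C] are treated one by one: a short word sending the current image of the
    next state into [C] is appended, and closure keeps the earlier ones inside. *)
Lemma short_word_into (C : {set A}) :
  (forall q a, q \in C -> trans q a \in C) ->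
  (forall q : A, exists u, delta q u \in C) ->
  exists2 u, forall q, delta q u \in C & size u <= #|~: C| ^ 2.
Proof.
move=> closed toC.
have closedW q u : q \in C -> delta q u \in C.
  by elim: u q => //= a u IHu q qC; apply/IHu/closed.
have [u uC size_u] : exists2 u, {in enum (~: C), forall q, delta q u \in C} &
    size u <= size (enum (~: C)) * #|~: C|.
  elim: (enum _) => [|x s [u uC size_u]]; first by exists [::].
  have [v vC size_v] := short_word_to (toC (delta x u)).
  exists (u ++ v); last by rewrite size_cat mulSn addnC leq_add.
  move=> q; rewrite inE delta_cat => /predU1P[-> //|/uC]; exact: closedW.
exists u; last by rewrite -cardE in size_u.
by move=> q; have [/closedW //|qC] := boolP (q \in C); apply/uC; rewrite mem_enum inE.
Qed.

End DeltaFacts.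

(** * Kernel congruences of morphisms *)

Section Morphism.
Variables (S : finType) (B A : dfa S) (f : B -> A).
Hypothesis f_trans : forall q a, f (trans q a) = trans (f q) a.

Lemma morph_delta q u : f (delta q u) = delta (f q) u.
Proof. by elim: u q => //= a u IHu q; rewrite IHu f_trans. Qed.

Let ker (x y : B) := f x == f y.

Lemma ker_refl : reflexive ker. Proof. by move=> x; apply: eqxx. Qed.
Lemma ker_sym : symmetric ker. Proof. by move=> x y; apply: eq_sym. Qed.
Lemma ker_trans : transitive ker.
Proof. by move=> y x z /eqP xy /eqP yz; rewrite /ker xy yz. Qed.

Definition ker_equiv : equiv_rel B := EquivRel ker ker_refl ker_sym ker_trans.

Lemma ker_delta q1 q2 u :
  ker_equiv q1 q2 -> ker_equiv (delta q1 u) (delta q2 u).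
Proof. by rewrite /= /ker !morph_delta => /eqP->. Qed.

Definition ker_cong : congruence B := Congruence ker_delta.

Local Open Scope quotient_scope.

Lemma ker_piE (x y : B) :
  (\pi_(quot_state ker_cong) x == \pi_(quot_state ker_cong) y) = (f x == f y).
Proof. by apply/eqP/eqP => [/eqmodP/eqP | eqf] //; apply/eqmodP/eqP. Qed.

Lemma ker_cong_index : cong_index ker_cong <= #|A|.
Proof.
apply: (@leq_card _ _ (fun x : quot_state ker_cong => f (repr x))).
by move=> x y eqf; rewrite -(reprK x) -(reprK y); apply/eqP; rewrite ker_piE eqf.
Qed.

(** [f] is constant on kernel classes and separates them, so states of [A] merge under [u] as soon
    as the classes of their preimages do. *)
Lemma ker_quotient_Syn :
  (forall q, exists x, f x = q) ->
  forall u, Syn (quotient ker_cong) u -> Syn A u.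
Proof.
move=> f_surj u /SynP uB; apply/SynP => q q'.
have [[x <-] [x' <-]] := (f_surj q, f_surj q').
rewrite -!morph_delta; apply/eqP; rewrite -ker_piE -!quot_delta.
exact/eqP/uB.
Qed.

End Morphism.

Lemma quotient_Syn (S : finType) (A : dfa S) (rho : congruence A) u :
  Syn A u -> Syn (quotient rho) u.
Proof.
move=> /SynP uA; apply/SynP => x y.
by rewrite -(reprK x) -(reprK y) !quot_delta (uA _ (repr y)).
Qed.

(** * Reachable parts and automata with a register *)

Section ReachablePart.
Variables (S : finType) (A : dfa S) (x0 : A).

Definition step : rel A := fun x y => [exists a, trans x a == y].

Lemma reachP y : reflect (exists u, delta x0 u = y) (connect step x0 y).
Proof.
apply: (iffP idP) => [/connectP[p] | [u <-]].
  elim: p x0 => [|z p IHp] x /=; first by move=> _ ->; exists [::].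
  by case/andP=> /existsP[a /eqP <-] /IHp h /h[u <-]; exists (a :: u).
elim: u x0 => //= a u IHu x; apply: connect_trans (IHu _).
by apply/connect1/existsP; exists a.
Qed.

Definition reach_state := {x : A | connect step x0 x}.

Lemma reach_trans_subproof (x : reach_state) a :
  connect step x0 (trans (val x) a).
Proof.
apply: connect_trans (valP x) _.
by apply/connect1/existsP; exists a.
Qed.

Definition reach_init : reach_state := Sub x0 (connect0 step x0).

Lemma reach_state_gt0 : 0 < #|{: reach_state}|.
Proof. by apply/card_gt0P; exists reach_init. Qed.

Definition reach_dfa : dfa S :=
  Dfa reach_state_gt0 (fun x a => Sub (trans (val x) a) (reach_trans_subproof x a)).

Lemma val_reach_delta (x : reach_dfa) u : val (delta x u) = delta (val x) u.
Proof. by apply: (@morph_delta S reach_dfa A val). Qed.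

Lemma reach_dfa_reachable (x : reach_dfa) :
  exists u, delta (reach_init : reach_dfa) u = x.
Proof.
by have /reachP[u ux] := valP x; exists u; apply/val_inj; rewrite val_reach_delta.
Qed.

End ReachablePart.

Section Window.
Variables (S : finType) (A : dfa S) (m : nat).

Lemma window_gt0 (w : m.-tuple S) : 0 < #|{: A * m.-tuple S}|.
Proof.
by have /card_gt0P[q _] := state_gt0 A; apply/card_gt0P; exists (q, w).
Qed.

(* The second component holds the last m letters read; w only witnesses that
   the state set is non-empty. *)
Definition window_dfa (w : m.-tuple S) : dfa S :=
  Dfa (window_gt0 w)
    (fun x a => (trans x.1 a, behead_tuple (rcons_tuple x.2 a) : m.-tuple S)).

Lemma window_delta1 w (x : window_dfa w) u : (delta x u).1 = delta x.1 u.
Proof. by apply: (@morph_delta S (window_dfa w) A fst). Qed.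

Lemma window_delta2 w (x : window_dfa w) u :
  (delta x u).2 = drop (size u) (x.2 ++ u) :> seq S.
Proof.
elim: u x => [|a u IHu] x /=; first by rewrite cats0 drop0.
by rewrite IHu /= -cat_rcons; case: (val x.2) => [|b s].
Qed.

End Window.

(** * The automaton B built over a strongly connected A *)

Section StronglyConnected.
Variables (S : finType) (A : dfa S) (w : seq S) (q0 : A).
Hypothesis w_reset : forall q : A, delta q w = q0.
Hypothesis q0_reach : forall q : A, exists u, delta q0 u = q.

Let W := window_dfa A (in_tuple w).
Let w0 : W := (q0, in_tuple w).

Definition window_acceptor : acceptor S :=
  @Acceptor S (reach_dfa w0) (reach_init w0) [set reach_init w0].

Lemma window_reset (x : window_acceptor) : delta x w = init window_acceptor.
Proof.
apply/val_inj; rewrite val_reach_delta /= [LHS]surjective_pairing.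
congr (_, _); first by rewrite window_delta1 w_reset.
apply/val_inj/(etrans (window_delta2 _ _)).
by rewrite drop_cat size_tuple ltnn subnn drop0.
Qed.

Lemma window_Syn : Syn window_acceptor w.
Proof. by apply/SynP => x y; rewrite !window_reset. Qed.

Lemma window_calL : in_calL window_acceptor.
Proof.
split=> //.
  by split=> [q|q _]; [exact: reach_dfa_reachable | exists q, [::]].
exists w => v; rewrite /language /lquot_suffix suffixE inE size_cat addKn.
rewrite -(inj_eq val_inj) val_reach_delta /=.
apply/eqP/eqP => [vw | vw].
  by rewrite -[X in drop _ (X ++ _)]/(val w0.2) -window_delta2 vw.
rewrite [LHS]surjective_pairing; congr (_, _); last first.
  exact/val_inj/(etrans (window_delta2 _ _)).
(* As [w] fixes [q0], reading [v] from [q0] amounts to reading [w ++ v], which ends in [w] and so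
   leads to [q0]. *)
rewrite window_delta1 /= -[X in delta X v](w_reset q0) -delta_cat.
by rewrite -(cat_take_drop (size v) (w ++ v)) vw delta_cat w_reset.
Qed.

Definition window_proj (x : window_acceptor) : A := (val x).1.

Lemma window_proj_trans (x : window_acceptor) a :
  window_proj (trans x a) = trans (window_proj x) a.
Proof. by []. Qed.

Lemma window_proj_surj q : exists x, window_proj x = q.
Proof.
have [u <-] := q0_reach q.
exists (delta (init window_acceptor) u).
by rewrite /window_proj val_reach_delta window_delta1.
Qed.

End StronglyConnected.

(** * The two implications *)

Lemma lt_sqrtD1 (k m : nat) : 0 < k ->
  ((k%:Z%:~R : realalg) < Num.sqrt (m%:R : realalg) + 1)%R = ((k - 1) ^ 2 < m).
Proof.
(* Cancel 1 and write k - 1 as the root of its square, so that two square roots are compared. *)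
case: k => // k _; rewrite subn1 /= -[k.+1%:Z%:~R%R]/(k.+1%:R)%R -natr1 ltrD2r.
rewrite -[(k%:R)%R]ger0_norm ?ler0n // -sqrtr_sqr -natrX.
have [->|m_gt0] := posnP m; first by rewrite sqrtr0 ltNge sqrtr_ge0.
by rewrite ltr_sqrt ?ltr0n // ltr_nat.
Qed.

Definition quotient_condition : Prop :=
  forall (S : finType), 0 < #|S| ->
  forall (B : acceptor S) (hB : in_calL B) (k : int),
    (k%:~R < Num.sqrt ((min_length (calL_sync hB))%:R : realalg) + 1)%R ->
  forall rho : congruence B, Cong k rho ->
    min_length (quotient_sync rho (calL_sync hB)) < min_length (calL_sync hB).

Lemma Cerny_strongly_connected (S : finType) (A : dfa S) :
  quotient_condition -> synchronizing A ->
  (forall p q : A, exists u, delta p u = q) ->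
  exists2 u, Syn A u & size u <= (#|A| - 1) ^ 2.
Proof.
move=> cond syncA sc; have [[w wA w_min] min] := min_lengthP syncA.
exists w => //; rewrite -w_min in min.
(* The condition speaks of non-empty alphabets only; over the empty one, [w] is empty. *)
have [S0|S_gt0] := posnP #|S|.
  by case: w {wA w_min min} => // a; have := fintype0 a S0.
have /card_gt0P[q1 _] := state_gt0 A.
have w_reset q : delta q w = delta q1 w by apply/SynP.
have q0_reach := sc (delta q1 w).
pose hB := window_calL w_reset.
pose rho := ker_cong (@window_proj_trans S A w (delta q1 w)).
have quot_min u : Syn (quotient rho) u -> size w <= size u.
  by move/(ker_quotient_Syn (window_proj_surj w q0_reach))/min.
have [[v vB v_min] minB] := min_lengthP (calL_sync hB).
have [[v' v'Q v'_min] _] := min_lengthP (quotient_sync rho (calL_sync hB)).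
rewrite leqNgt; apply/negP => w_gt.
(* This contradicts ||Syn B|| <= |w| <= ||Syn (B/rho)||. *)
suff : min_length (quotient_sync rho (calL_sync hB)) < min_length (calL_sync hB).
  rewrite ltnNge => /negP; apply; apply: leq_trans (minB _ (window_Syn w_reset)) _.
  by rewrite -v'_min quot_min.
apply: (cond S S_gt0 _ hB (cong_index rho)%:Z%R) => //.
rewrite lt_sqrtD1 ?quot_state_gt0 //.
have sqr_le : (cong_index rho - 1) ^ 2 <= (#|A| - 1) ^ 2.
  by rewrite leq_sqr leq_sub2r // ker_cong_index.
apply: leq_ltn_trans sqr_le (leq_trans w_gt _).
(* A reset word of B also resets B/rho, hence has length at least |w|. *)
rewrite -v_min; apply: quot_min.
exact: quotient_Syn.
Qed.

Lemma Cerny_of_quotient_condition : quotient_condition -> Cerny_conjecture.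
Proof.
move=> cond S A [w /SynP wA].
have /card_gt0P[q1 _] := state_gt0 A.
pose q0 := delta q1 w; pose A0 := reach_dfa q0.
pose C := [set q | connect (@step S A) q0 q].
have A0_reset (x : A0) : delta x w = reach_init q0.
  by apply/val_inj; rewrite val_reach_delta; apply: wA.
have syncA0 : synchronizing A0.
  by exists w; apply/SynP => x y; rewrite !A0_reset.
(* Any state returns to [q0] by [w], and [q0] reaches every state of [A0]. *)
have scA0 (p q : A0) : exists u, delta p u = q.
  by have [u <-] := reach_dfa_reachable q; exists (w ++ u); rewrite delta_cat A0_reset.
have [v /SynP vA0 size_v] := Cerny_strongly_connected cond syncA0 scA0.
have closed q a : q \in C -> trans q a \in C.
  rewrite !inE => q0q; exact: (@reach_trans_subproof S A q0 (Sub q q0q)).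
have toC (q : A) : exists u, delta q u \in C.
  by exists w; rewrite inE (wA q q1) connect0.
have [u uC size_u] := short_word_into closed toC.
exists (u ++ v).
  apply/SynP => q q'; rewrite !delta_cat.
  have := uC q; have := uC q'; rewrite !inE => r' r.
  have := congr1 val (vA0 (Sub _ r) (Sub _ r')).
  by rewrite !val_reach_delta.
have cardA0 : #|A0| = #|C| by rewrite card_sig cardsE.
rewrite size_cat; rewrite cardA0 in size_v.
have C_gt0 : 0 < #|C| by rewrite -cardA0 state_gt0.
rewrite -(cardsC C); apply: leq_trans (leq_add size_u size_v) _.
have -> : #|C| + #|~: C| - 1 = #|~: C| + (#|C| - 1) by lia.
by rewrite sqrnD leq_addr.
Qed.

Theorem theorem7 :
  Cerny_conjecture <->
  forall (S : finType), 0 < #|S| ->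
  forall (B : acceptor S) (hB : in_calL B) (k : int),
    (k%:~R < Num.sqrt ((min_length (calL_sync hB))%:R : realalg) + 1)%R ->
  forall rho : congruence B, Cong k rho ->
    min_length (quotient_sync rho (calL_sync hB)) < min_length (calL_sync hB).
Proof.
split=> [cerny S _ B hB k k_lt rho rho_k|]; last exact: Cerny_of_quotient_condition.
(* It remains to bound ||Syn (B/rho)|| by (k-1)^2, which is the conjecture for B/rho. *)
move: k_lt; rewrite -rho_k lt_sqrtD1 ?quot_state_gt0 //; apply: leq_ltn_trans.
have [u uQ size_u] := cerny S _ (quotient_sync rho (calL_sync hB)).
have [_ min] := min_lengthP (quotient_sync rho (calL_sync hB)).
exact: leq_trans (min u uQ) size_u.
Qed.
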